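(* Let $a$ be a fixed non-negative integer. Then $\mathbb{E}[\mathbf{Y}_n^a]\to\mathbb{E}[\mathbf{Y}^a]$ as $n\to\infty$. In particular, if $\pi\in\mathfrak{S}_n$ is chosen uniformly, then \[ \mathbb{E}[d(\pi)]\to 1+\sum_{d=0}^{\infty}e^{-d^2-d}\quad(\approx 2.13782) \] as $n\to\infty$.
   Context: For $\pi\in\mathfrak{S}_n$ ($n\ge2$), $d(\pi)=\min_{1\le i<j\le n}\big(|i-j|+|\pi(i)-\pi(j)|\big)$. $\mathbf{Y}_n$ is the random variable $d(\pi)$ for $\pi\in\mathfrak{S}_n$ uniform. $\mathbf{Y}$ is the integer-valued random variable with $\Pr{\mathbf{Y}\ge d+2}=e^{-d^2-d}$ for every integer $d\ge0$ (so $\mathbf{Y}\ge2$ almost surely and $\Pr{\mathbf{Y}=d+2}=e^{-d^2-d}-e^{-(d+1)^2-(d+1)}$ for $d\ge0$). *)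

(* Defs.v *)
From mathcomp Require Import all_boot all_fingroup.
Set Implicit Arguments. Unset Strict Implicit. Unset Printing Implicit Defensive.

Definition absdiffn (m n : nat) : nat := (m - n) + (n - m).

(* d(pi) = min_{i<j} |i-j| + |pi i - pi j|, for pi in S_n (indices 0..n-1;
   the quantity is shift invariant).  The neutral element 2*n of the min is
   never attained-below: for n >= 2 the index set is nonempty and every term
   is <= 2*(n-1) < 2*n, so this is the genuine minimum. *)
Definition dperm (n : nat) (p : 'S_n) : nat :=
  \big[minn/(2 * n)%N]_(i : 'I_n) \big[minn/(2 * n)%N]_(j : 'I_n | (i < j)%N)
     (absdiffn i j + absdiffn (p i) (p j))%N.

Definition sum_dperm_pow (n a : nat) : nat := (\sum_(p : 'S_n) (dperm p) ^ a)%N.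

From Stdlib Require Import Reals.
Open Scope R_scope.

Definition EYn_pow (n a : nat) : R := INR (sum_dperm_pow n a) / INR (factorial n).

(* Pr[Y = d+2] = e^{-d^2-d} - e^{-(d+1)^2-(d+1)} *)
Definition probY (d : nat) : R :=
  exp (- (INR d)^2 - INR d) - exp (- (INR d + 1)^2 - (INR d + 1)).

Definition EY_pow_term (a d : nat) : R := (INR d + 2) ^ a * probY d.

(* Main.v *)
Require Import Defs.
From Stdlib Require Import Factorial Reals Lra.
From mathcomp Require Import all_boot all_fingroup.
From mathcomp Require Import zify.
Set Implicit Arguments. Unset Strict Implicit. Unset Printing Implicit Defensive.

(**
Let N_s(p) count the pairs i < j with |i - j| + |p i - p j| <= s, so that
d(p) >= d + 2 iff N_(d+1)(p) = 0.  Everything rests on one switching identity: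
fix an anchor i and a position j, and swap the values of p so that j receives a
value w close to p i.  Each permutation in which j already has the value w arises
n - 1 times, whence
  (n - 1) sum_q N_s(q) F(q) = sum_p sum_(i, j, w) F(switch p j w).

With F = 1, N_s or a local overlap count, this bounds the corresponding moments.
With F = [N_s = k + 1], a switch raises N_s by exactly one unless some overlap
occurs, and there are about n * s(s - 1) switches; hence (k + 1) P(N_s = k + 1) -
s(s - 1) P(N_s = k) -> 0 for each k.  Together with the bound on E(N_s), which
gives tightness, this forces P(N_s = 0) -> exp(- s(s - 1)).

For the tail, a permutation with d(p) >= D + 2 that undergoes k switches still
has at most 2k(2k + 1) close pairs at scale s = (D + 1)/2, while there are at
least (n - 1)(s - 1) switches at every step; iterating the identity K times gives
P(d(p) >= D + 2) = O(D^-K) uniformly in n, and dominated convergence of series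
(Tannery) yields the convergence of all moments.
*)

Local Open Scope nat_scope.

(** * The switching identity *)

Definition near n s (p : 'S_n) (i j : 'I_n) : bool :=
  (i != j) && (absdiffn i j + absdiffn (p i) (p j) <= s).

Definition near_pairs n s (p : 'S_n) : nat :=
  \sum_(i : 'I_n) \sum_(j : 'I_n | i < j) near s p i j.

Definition degree n s (p : 'S_n) (i : 'I_n) : nat := \sum_j near s p i j.

(** The values [w] that make [j] close to the anchor [i] once [j] receives [w]; [w != p i] keeps the
    value at [i] untouched. The trivial switch [w = p j] is allowed. *)
Definition target n s (p : 'S_n) (i j w : 'I_n) : bool :=
  (i != j) && (w != p i) && (absdiffn i j + absdiffn (p i) w <= s).

(* [j] receives the value [w] and the former holder of [w] receives [p j]. *)
Definition switch n (p : 'S_n) (j w : 'I_n) : 'S_n := (tperm j (p^-1 w) * p)%g.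

Lemma absdiffnC m n : absdiffn m n = absdiffn n m.
Proof. by rewrite /absdiffn addnC. Qed.

Lemma nearC n s (p : 'S_n) i j : near s p i j = near s p j i.
Proof. by rewrite /near eq_sym absdiffnC (absdiffnC (p i)). Qed.

Lemma sum_degree n s (p : 'S_n) : \sum_i degree s p i = 2 * near_pairs s p.
Proof.
rewrite mul2n -addnn {2}/near_pairs.
under [X in _ = _ + X]eq_bigr => i _ do rewrite big_mkcond.
rewrite [X in _ = _ + X]exchange_big /near_pairs -big_split /=; apply: eq_bigr => i _.
rewrite [X in _ = X + _]big_mkcond -big_split /=; apply: eq_bigr => j _.
rewrite (nearC _ _ j) /near -val_eqE /=.
by case: (ltngtP i j); rewrite ?addn0.
Qed.

(** For fixed [y], left multiplication by [tperm j y] matches the [p] with [p y = w] with the [q]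
    with [q j = w] and preserves the value at [i]. Any [y] except [i] can have held [w], since [i]
    holds [v]. *)
Lemma switch_sum n (i j v w : 'I_n) (G : 'I_n -> 'S_n -> nat) :
  i != j -> v != w ->
  \sum_(q : 'S_n | (q i == v) && (q j == w)) \sum_(y | y != i) G y q =
  \sum_(p : 'S_n | p i == v) G ((p^-1)%g w) (switch p j w).
Proof.
move=> nij nvw; rewrite exchange_big /=.
rewrite [RHS](partition_big (fun p : 'S_n => (p^-1)%g w) (fun y => y != i)) /=; last first.
  by move=> p /eqP pi; apply: contraNneq nvw => pwi; rewrite -pi -pwi permKV.
apply: eq_bigr => y nyi.
rewrite (reindex_inj (mulgI (tperm j y))) /=.
apply: eq_big => [p|p /andP[_]].
  rewrite !permM tpermL (tpermD _ _) 1?[j == i]eq_sym //; congr (_ && _).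
  by apply/eqP/eqP => [<-|<-]; rewrite ?permK ?permKV.
by rewrite permM tpermL /switch => /eqP <-; rewrite permK.
Qed.

(* On the right, [i] is the anchor, [j] the position moved next to it, and [y] on the
   left is the position that held [w] before the switch. *)
Lemma sum_near_switch n s (P : rel 'I_n) (G : 'I_n -> 'I_n -> 'I_n -> 'S_n -> nat) :
  \sum_(q : 'S_n) \sum_i \sum_(j | P i j) near s q i j * \sum_(y | y != i) G i j y q =
  \sum_(p : 'S_n) \sum_i \sum_(j | P i j) \sum_(w | target s p i j w)
     G i j ((p^-1)%g w) (switch p j w).
Proof.
rewrite exchange_big [RHS]exchange_big /=; apply: eq_bigr => i _.
rewrite exchange_big [RHS]exchange_big /=; apply: eq_bigr => j _.
have [->|nij] := eqVneq i j.
  rewrite !big1 // => p _; first by rewrite big1 // => w; rewrite /target eqxx.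
  by rewrite /near eqxx.
pose ok (v w : 'I_n) := (w != v) && (absdiffn i j + absdiffn v w <= s).
(* Once the values [v] at [i] and [w] at [j] are fixed, closeness depends on [v] and [w] alone, and
   [switch_sum] applies to each such pair. *)
transitivity (\sum_v \sum_(w | ok v w)
   \sum_(q : 'S_n | (q i == v) && (q j == w)) \sum_(y | y != i) G i j y q).
  rewrite (partition_big (fun q : 'S_n => q i) xpredT) //=; apply: eq_bigr => v _.
  rewrite [RHS]big_mkcond /= (partition_big (fun q : 'S_n => q j) xpredT) //=.
  apply: eq_bigr => w _; case: ifP => okvw.
    apply: eq_bigr => q /andP[/eqP qi /eqP qj].
    by rewrite /near qi qj nij; case/andP: okvw => _ ->; rewrite mul1n.
  rewrite big1 // => q /andP[/eqP qi /eqP qj].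
  move: okvw; rewrite /near qi qj nij /ok -qi -qj (inj_eq perm_inj) eq_sym nij /=.
  by move=> ->.
rewrite [RHS](partition_big (fun q : 'S_n => q i) xpredT) //=.
apply: eq_bigr => v _.
rewrite (eq_bigr (fun w => \sum_(p : 'S_n | p i == v) G i j ((p^-1)%g w) (switch p j w))); last first.
  by move=> w /andP[nwv _]; rewrite switch_sum // eq_sym.
rewrite exchange_big /=; apply: eq_bigr => p /eqP pi.
by apply: eq_bigl => w; rewrite /target nij pi.
Qed.

(** * Counting points in truncated intervals *)

Lemma sum_interval n lo hi :
  \sum_(w < n) ((lo <= w) && (w < hi) : nat) = minn hi n - lo.
Proof.
elim: n => [|n IH]; first by rewrite big_ord0; lia.
by rewrite big_ord_recr /= IH; lia.
Qed.

Lemma punctured_ball_card n (v : 'I_n) t :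
  \sum_(w : 'I_n) ((w != v) && (absdiffn v w <= t) : nat) =
  (v - (v - t)) + (minn (v + t).+1 n - v.+1).
Proof.
have := sum_interval n (v - t) v; rewrite (minn_idPl (ltnW (ltn_ord v))) => <-.
rewrite -sum_interval -big_split /=.
by apply: eq_bigr => w _; rewrite -val_eqE /absdiffn /=; lia.
Qed.

Lemma ball_card n (v : 'I_n) t : \sum_(w : 'I_n) (absdiffn v w <= t : nat) <= (2 * t).+1.
Proof.
apply: (@leq_trans (\sum_(w < n) ((v - t <= w) && (w < (v + t).+1) : nat))).
  by apply: leq_sum => w _; rewrite /absdiffn; lia.
by rewrite sum_interval; lia.
Qed.

(* The second summand is the mass that the boundary [n] cuts off; it vanishes when
   [i + s < n]. *)
Lemma sum_gap n i s :
  \sum_(j < n) (i < j) * (2 * (s - (j - i))) +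
    (s - (n - i.+1)) * (s - (n - i.+1)).-1 = s * s.-1.
Proof.
elim: n => [|n IH]; first by rewrite big_ord0 subn0; lia.
rewrite big_ord_recr /= -IH -addnA; congr (_ + _).
case: (ltnP i n) => ni; last by rewrite (_ : n.+1 - i.+1 = n - i.+1) //; lia.
have -> : n.+1 - i.+1 = (n - i.+1).+1 by lia.
have -> : n - i = (n - i.+1).+1 by lia.
by set r := n - i.+1; case: (ltnP r s) => rs; nia.
Qed.

(** * Moment bounds *)

(** Relaxing the joint constraint to two independent ones lets the three sums be taken in any
    order. *)
Lemma target_sum_le n s (p : 'S_n) (P : rel 'I_n) (f : 'I_n -> 'I_n -> 'I_n -> nat) :
  \sum_i \sum_(j | P i j) \sum_(w | target s p i j w) f i j w <=
  \sum_(i : 'I_n) \sum_(j : 'I_n) \sum_(w : 'I_n)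
     (absdiffn i j <= s) * (absdiffn (p i) w <= s) * f i j w.
Proof.
apply: leq_sum => i _; rewrite big_mkcond; apply: leq_sum => j _.
case: ifP => // _; rewrite big_mkcond; apply: leq_sum => w _.
case: ifP => // /andP[_ le_s].
have -> : absdiffn i j <= s by lia.
by have -> : absdiffn (p i) w <= s; lia.
Qed.

(** Here and in the next two bounds: a given point is the anchor, the moved position or the
    displaced position of at most [(2 * s).+1 ^ 2] switches, because the other two choices each
    range over a ball of radius [s]. *)
Lemma target_sum_anchor n s (p : 'S_n) (P : rel 'I_n) (a : 'I_n -> nat) :
  \sum_i \sum_(j | P i j) \sum_(w | target s p i j w) a i <=
  (2 * s).+1 ^ 2 * \sum_i a i.
Proof.
apply: leq_trans (target_sum_le _ _ _ _) _.
rewrite big_distrr /=; apply: leq_sum => i _.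
under eq_bigr => j _ do rewrite -big_distrl -big_distrr /=.
rewrite -!big_distrl /= leq_mul2r -mulnn leq_mul ?orbT //; exact: ball_card.
Qed.

Lemma target_sum_moved n s (p : 'S_n) (P : rel 'I_n) (a : 'I_n -> nat) :
  \sum_i \sum_(j | P i j) \sum_(w | target s p i j w) a j <=
  (2 * s).+1 ^ 2 * \sum_j a j.
Proof.
apply: leq_trans (target_sum_le _ _ _ _) _.
rewrite exchange_big big_distrr /=; apply: leq_sum => j _.
under eq_bigr => i _ do rewrite -big_distrl -big_distrr /=.
rewrite -!big_distrl /= leq_mul2r -mulnn; apply/orP; right.
apply: (@leq_trans (\sum_(i : 'I_n) (absdiffn j i <= s) * (2 * s).+1)).
  by apply: leq_sum => i _; rewrite absdiffnC leq_mul2l ball_card orbT.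
by rewrite -big_distrl leq_mul2r ball_card orbT.
Qed.

Lemma target_sum_displaced n s (p : 'S_n) (P : rel 'I_n) (a : 'I_n -> nat) :
  \sum_i \sum_(j | P i j) \sum_(w | target s p i j w) a ((p^-1)%g w) <=
  (2 * s).+1 ^ 2 * \sum_y a y.
Proof.
apply: leq_trans (target_sum_le _ _ _ _) _.
rewrite [in leqRHS](reindex_perm (p^-1)%g) big_distrr /=.
under eq_bigr => i _ do rewrite exchange_big /=.
rewrite exchange_big; apply: leq_sum => w _ /=.
under eq_bigr => i _ do rewrite -!big_distrl /=.
rewrite -!big_distrl /= leq_mul2r -mulnn; apply/orP; right.
apply: (@leq_trans (\sum_(i : 'I_n) (2 * s).+1 * (absdiffn w (p i) <= s))).
  by apply: leq_sum => i _; rewrite absdiffnC leq_mul2r ball_card orbT.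
have -> : \sum_(i : 'I_n) (2 * s).+1 * (absdiffn w (p i) <= s) =
    \sum_(v : 'I_n) (2 * s).+1 * (absdiffn w v <= s) by rewrite [RHS](reindex_perm p).
by rewrite -big_distrr leq_mul2l ball_card orbT.
Qed.

Definition targets n s (p : 'S_n) : nat :=
  \sum_(i : 'I_n) \sum_(j : 'I_n | i < j) \sum_(w | target s p i j w) 1.

(** [F] ignores which position held [w] before, so the free position contributes the factor
    [n.-1]. *)
Lemma near_pairs_switch n s (F : 'S_n -> nat) :
  n.-1 * \sum_(q : 'S_n) near_pairs s q * F q =
  \sum_(p : 'S_n) \sum_(i : 'I_n) \sum_(j : 'I_n | i < j)
    \sum_(w | target s p i j w) F (switch p j w).
Proof.
rewrite -(sum_near_switch s (fun i j : 'I_n => i < j) (fun _ _ _ q => F q)).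
rewrite big_distrr; apply: eq_bigr => q _ /=.
rewrite mulnCA /near_pairs big_distrl; apply: eq_bigr => i _ /=.
rewrite big_distrl; apply: eq_bigr => j _ /=.
by rewrite sum_nat_const cardC1 card_ord; lia.
Qed.

Lemma targets_le n s (p : 'S_n) : targets s p <= (2 * s).+1 ^ 2 * n.
Proof.
apply: leq_trans (target_sum_anchor _ _ _ (fun=> 1)) _.
by rewrite sum1_card card_ord.
Qed.

(** First moment, from the identity with [F = 1]; the leading 2 absorbs the quotient of [n] by
    [n.-1]. *)
Lemma sum_near_pairs_le n s : 1 < n ->
  \sum_(q : 'S_n) near_pairs s q <= 2 * (2 * s).+1 ^ 2 * n`!.
Proof.
move=> n_gt1; rewrite -(leq_pmul2l (_ : 0 < n.-1)); last by lia.
rewrite (eq_bigr (fun q => near_pairs s q * 1)) => [|q _]; last by rewrite muln1.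
rewrite near_pairs_switch.
apply: (@leq_trans (\sum_(p : 'S_n) (2 * s).+1 ^ 2 * n)).
  by apply: leq_sum => p _; apply: targets_le.
rewrite sum_nat_const card_Sn.
have : n <= 2 * n.-1 by lia.
move: (_ ^ 2) n`! => c f; nia.
Qed.

Lemma switch_anchor n s (p : 'S_n) i j w : target s p i j w -> switch p j w i = p i.
Proof.
case/andP=> /andP[nij nwi] _; rewrite permM tpermD //; first by rewrite eq_sym.
by apply: contraNneq nwi => <-; rewrite permKV.
Qed.

Lemma switch_moved n (p : 'S_n) j w : switch p j w j = w.
Proof. by rewrite permM tpermL permKV. Qed.

Lemma switch_other n (p : 'S_n) j w x :
  x != j -> x != (p^-1)%g w -> switch p j w x = p x.
Proof. by move=> xj xy; rewrite permM tpermD 1?eq_sym. Qed.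

Lemma near_switch_other n s (p : 'S_n) j w a b :
  a != j -> a != (p^-1)%g w -> b != j -> b != (p^-1)%g w ->
  near s (switch p j w) a b = near s p a b.
Proof. by move=> *; rewrite /near !switch_other. Qed.

(** Only pairs meeting [j] or [y] can become close: two points, each as first or second entry of the
    pair, with at most [(2 * s).+1] partners in every case. *)
Lemma near_pairs_switch_le n s (p : 'S_n) j w :
  near_pairs s (switch p j w) <= near_pairs s p + 4 * (2 * s).+1.
Proof.
set y := (p^-1)%g w.
pose ball (z : 'I_n) := \sum_(a : 'I_n) \sum_(b : 'I_n) (a == z) * (absdiffn a b <= s).
have ball_le z : ball z <= (2 * s).+1.
  rewrite /ball (bigD1 z) //= [X in _ + X]big1 => [|a /negPf ->]; last by rewrite big1.
  by rewrite addn0 eqxx; under eq_bigr do rewrite mul1n; apply: ball_card.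
have ballC z : ball z = \sum_(a : 'I_n) \sum_(b : 'I_n) (b == z) * (absdiffn a b <= s).
  by rewrite exchange_big; apply: eq_bigr => a _; apply: eq_bigr => b _; rewrite absdiffnC.
apply: (@leq_trans (near_pairs s p + (ball j + ball y + (ball j + ball y)))); last first.
  by have := ball_le j; have := ball_le y; lia.
rewrite {2}(ballC j) {2}(ballC y) /ball /near_pairs -!big_split; apply: leq_sum => a _ /=.
rewrite -!big_split /= big_mkcond [in leqRHS]big_mkcond -big_split /=.
apply: leq_sum => b _; case: ifP => // _.
have [a_j|aj] := eqVneq a j; last have [a_y|ay] := eqVneq a y;
  last have [b_j|bj] := eqVneq b j; last have [b_y|byy] := eqVneq b y.
all: rewrite ?(near_switch_other s aj ay bj byy) ?leq_addr //=.
all: rewrite /near; case: (boolP (absdiffn a b <= s)) => ab; last by lia.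
all: by lia.
Qed.

(** Second moment: take [F] to be [near_pairs s] in the identity. A switch adds only a bounded
    amount to it, so the first moment suffices. *)
Lemma sum_near_pairs2_le n s : 1 < n ->
  \sum_(q : 'S_n) near_pairs s q * near_pairs s q <=
  2 * (2 * s).+1 ^ 2 * (2 * (2 * s).+1 ^ 2 + 4 * (2 * s).+1) * n`!.
Proof.
move=> n_gt1; rewrite -(leq_pmul2l (_ : 0 < n.-1)); last by lia.
rewrite near_pairs_switch.
apply: (@leq_trans (\sum_(p : 'S_n) (2 * s).+1 ^ 2 * n * (near_pairs s p + 4 * (2 * s).+1))).
  apply: leq_sum => p _.
  apply: (@leq_trans (targets s p * (near_pairs s p + 4 * (2 * s).+1))).
    rewrite /targets !big_distrl; apply: leq_sum => i _ /=.
    rewrite !big_distrl; apply: leq_sum => j _ /=.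
    by rewrite !big_distrl; apply: leq_sum => w _ /=; rewrite mul1n near_pairs_switch_le.
  by rewrite leq_mul2r targets_le orbT.
rewrite -big_distrr big_split /= sum_nat_const card_Sn.
have := sum_near_pairs_le s n_gt1.
have : n <= 2 * n.-1 by lia.
move: (_ ^ 2) (4 * _) n`! (\sum_q _) => c e f S len leS.
apply: (@leq_trans (c * (2 * n.-1) * (2 * c * f + f * e))); last by lia.
by rewrite leq_mul // ?leq_mul // leq_add2r.
Qed.

(* If the switch brings a second close neighbour [x] to the anchor, then [x] was already
   close to it at scale [2 * s]: either [x] was untouched, or [x] used to hold [w]. *)
Lemma sum_overlap_le n s : 1 < n ->
  n.-1 * \sum_(q : 'S_n) \sum_i \sum_j near s q i j * \sum_(x | x != j) near s q i x <=
  4 * (2 * s).+1 ^ 2 * (2 * (2 * s)).+1 ^ 2 * n`!.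
Proof.
move=> n_gt1.
apply: (@leq_trans (\sum_(p : 'S_n) (2 * s).+1 ^ 2 * \sum_i degree (2 * s) p i)).
  (* The factor [n.-1] is spread into a sum over a free position [y], the shape that the switching
     identity needs. *)
  have -> : n.-1 * (\sum_(q : 'S_n) \sum_i \sum_j near s q i j * \sum_(x | x != j) near s q i x)
    = \sum_(q : 'S_n) \sum_i \sum_j near s q i j * \sum_(y | y != i) \sum_(x | x != j) near s q i x.
    rewrite big_distrr; apply: eq_bigr => q _; rewrite big_distrr; apply: eq_bigr => i _.
    rewrite big_distrr; apply: eq_bigr => j _ /=.
    by rewrite sum_nat_const cardC1 card_ord mulnCA.
  rewrite (sum_near_switch s (fun _ _ => true) (fun i j y q => \sum_(x | x != j) near s q i x)).
  apply: leq_sum => p _; apply: leq_trans (target_sum_anchor _ _ _ _).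
  apply: leq_sum => i _; apply: leq_sum => j _; apply: leq_sum => w tw.
  rewrite /degree big_mkcond; apply: leq_sum => x _; case: ifP => // xj.
  rewrite /near (switch_anchor tw).
  have [xy|xy] := eqVneq x ((p^-1)%g w); last first.
    by rewrite switch_other //; case: (i != x) => //=; lia.
  have px : p x = w by rewrite xy permKV.
  case/andP: tw => _; rewrite px; case: (i != x) => //=; lia.
under eq_bigr => p _ do rewrite sum_degree.
rewrite -!big_distrr /=; have := sum_near_pairs_le (2 * s) n_gt1.
move: ((2 * s).+1 ^ 2) (_ ^ 2) n`! (\sum_q _) => c c' f S leS; nia.
Qed.

(** * The approximate Poisson recursion *)

Lemma target_count n s (p : 'S_n) (i j : 'I_n) : i < j ->
  \sum_(w | target s p i j w) 1 =
  (p i - (p i - (s - (j - i)))) + (minn (p i + (s - (j - i))).+1 n - (p i).+1).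
Proof.
move=> ij; rewrite -punctured_ball_card big_mkcond; apply: eq_bigr => w _ /=.
have -> : target s p i j w = (w != p i) && (absdiffn (p i) w <= s - (j - i)).
  by rewrite /target -!val_eqE /absdiffn /=; lia.
by case: ifP.
Qed.

Lemma targets_upper n s (p : 'S_n) : targets s p <= n * (s * s.-1).
Proof.
rewrite -[n in n * _]card_ord -sum_nat_const; apply: leq_sum => i _.
rewrite -(sum_gap n i s) (leq_trans _ (leq_addr _ _)) //.
rewrite big_mkcond; apply: leq_sum => j _; case: ifP => // ij.
rewrite target_count //; lia.
Qed.

(** At most [3 * s] anchors lie within [s] of the right end or have a value within [s] of either
    end; every other anchor contributes the full [s * s.-1]. *)
Lemma targets_lower n s (p : 'S_n) : (n - 3 * s) * (s * s.-1) <= targets s p.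
Proof.
pose good (i : 'I_n) := [&& i + s < n, s <= p i & p i + s < n].
apply: (@leq_trans (\sum_i good i * (s * s.-1))).
  rewrite -big_distrl leq_mul2r; apply/orP; right => /=.
  have cnt : \sum_(i : 'I_n) (((n - s <= i) && (i < n)) + ((0 <= p i) && (p i < s))
      + ((n - s <= p i) && (p i < n))) <= 3 * s.
    rewrite !big_split /=.
    have e lo hi : \sum_(i : 'I_n) ((lo <= p i) && (p i < hi) : nat) = minn hi n - lo.
      by rewrite -sum_interval [RHS](reindex_perm p).
    by have := e 0 s; have := e (n - s) n; have := sum_interval n (n - s) n => /= -> -> ->; lia.
  rewrite leq_subLR; apply: leq_trans (leq_add cnt (leqnn _)).
  rewrite -big_split /= -[leqLHS]card_ord -sum1_card; apply: leq_sum => i _.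
  by rewrite /good; have := ltn_ord i; have := ltn_ord (p i); lia.
apply: leq_sum => i _; case: (boolP (good i)) => //= /and3P[is_n s_pi pis_n].
rewrite mul1n -(sum_gap n i s) (_ : s - (n - i.+1) = 0) ?mul0n ?addn0; last by lia.
rewrite [leqRHS]big_mkcond; apply: leq_sum => j _; case: (ltnP i j) => // ij.
by rewrite target_count //; lia.
Qed.

(** A crude bound that stays useful when [s] grows with [n]: only [j = i + 1] is kept, and since
    [2 * s.-1 < n] at least one side of [p i] has room for [s.-1] values. *)
Lemma targets_ge n s (p : 'S_n) : 2 * s.-1 < n -> n.-1 * s.-1 <= targets s p.
Proof.
move=> s_n.
have e : \sum_(i < n) ((0 <= i) && (i < n.-1) : nat) = n.-1 by rewrite sum_interval; lia.
rewrite -{1}e big_distrl; apply: leq_sum => i _ /=.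
case: (ltnP i n.-1) => // i_n; have i1 : i.+1 < n by lia.
rewrite (bigD1 (Ordinal i1)) //= mul1n (leq_trans _ (leq_addr _ _)) // target_count //=.
by have := ltn_ord (p i); lia.
Qed.

Lemma sum_bool_eq0 (T : finType) (P f : pred T) x :
  \sum_(z | P z) (f z : nat) = 0 -> P x -> f x = false.
Proof.
move=> sum0 Px; apply/negbTE; rewrite -eqb0 -leqn0 -sum0.
by rewrite (bigD1 x) //= leq_addr.
Qed.

(** Pairs avoiding [j] and [y] keep their status. Those meeting [j] or [y] are not close before the
    switch, and [(i, j)] is the only one of them that is close after it. *)
Lemma near_pairs_succ n s (p : 'S_n) (i j w : 'I_n) (q := switch p j w) (y := (p^-1)%g w) :
  i < j -> target s p i j w ->
  degree s p j = 0 -> degree s p y = 0 ->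
  \sum_(x | x != i) near s q j x = 0 -> degree s q y = 0 ->
  near_pairs s q = (near_pairs s p).+1.
Proof.
move=> ij tw pj py qj qy.
have {}pj x : near s p j x = false by apply: sum_bool_eq0 pj _.
have {}py x : near s p y x = false by apply: sum_bool_eq0 py _.
have {}qy x : near s q y x = false by apply: sum_bool_eq0 qy _.
have {}qj x : x != i -> near s q j x = false by apply: sum_bool_eq0 qj.
have qij : near s q i j.
  rewrite /near (switch_anchor tw) switch_moved.
  by case/andP: tw => /andP[-> _] ->.
have key (a b : 'I_n) : a < b -> near s q a b = near s p a b + ((a == i) && (b == j)) :> nat.
  move=> ab.
  have [a_j|aj] := eqVneq a j.
    rewrite a_j in ab *; rewrite pj; have -> : (j == i) = false by rewrite -val_eqE /=; lia.
    have [bi|bi] := eqVneq b i; last by rewrite qj.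
    by move: ab; rewrite bi; lia.
  have [->|ay] := eqVneq a y.
    rewrite qy py /=; case: eqVneq => //= yi; case: eqVneq => // bj.
    by move: (qy j); rewrite yi qij.
  have [->|bj] := eqVneq b j.
    have [->|ai] := eqVneq a i; first by rewrite qij nearC pj.
    by rewrite nearC qj // nearC pj.
  rewrite andbF addn0.
  have [->|yb] := eqVneq b y; first by rewrite nearC qy nearC py.
  by rewrite near_switch_other.
rewrite /near_pairs -addn1.
have <- : \sum_(a : 'I_n) \sum_(b : 'I_n | a < b) ((a == i) && (b == j) : nat) = 1.
  rewrite (bigD1 i) //= (bigD1 j) //= !eqxx /= !big1 // => [a|b /andP[_]] /negPf -> //.
  by rewrite big1.
rewrite -big_split; apply: eq_bigr => a _ /=; rewrite -big_split.
by apply: eq_bigr => b /key.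
Qed.

(** Vanishes exactly when the four isolation hypotheses of [near_pairs_succ] hold. *)
Definition switch_defect n s (p : 'S_n) (i j w : 'I_n) : nat :=
  degree s p j + degree s p ((p^-1)%g w) +
  (\sum_(x | x != i) near s (switch p j w) j x + degree s (switch p j w) ((p^-1)%g w)).

(** Without defect the count rises by exactly one; a positive defect absorbs the error, as the
    indicators are at most 1. *)
Lemma switch_defectP n s (p : 'S_n) (i j w : 'I_n) k :
  i < j -> target s p i j w ->
  (near_pairs s (switch p j w) == k.+1 <= (near_pairs s p == k) + switch_defect s p i j w) /\
  (near_pairs s p == k <= (near_pairs s (switch p j w) == k.+1) + switch_defect s p i j w).
Proof.
move=> ij tw; case: (posnP (switch_defect s p i j w)) => [|gt0]; last first.
  by split; lia.
rewrite /switch_defect => d0.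
have -> : near_pairs s (switch p j w) = (near_pairs s p).+1.
  by apply: (near_pairs_succ ij tw); lia.
by rewrite eqSS; split; lia.
Qed.

(** The bounds for the four terms of the defect, added up, the first two being equal. *)
Definition defect_const s : nat :=
  let c := (2 * s).+1 ^ 2 in let c' := (2 * (2 * s)).+1 ^ 2 in
  8 * c * c + 8 * c * c' + 4 * c * (2 * c + 4 * (2 * s).+1).

(** The defects per permutation are bounded on average, whereas there are about [n * (s * s.-1)]
    switches, so they are negligible in the limit. *)
Lemma sum_switch_defect_le n s : 1 < n ->
  \sum_(p : 'S_n) \sum_(i : 'I_n) \sum_(j : 'I_n | i < j) \sum_(w | target s p i j w)
    switch_defect s p i j w <= defect_const s * n`!.
Proof.
move=> n_gt1.
pose S (f : 'S_n -> 'I_n -> 'I_n -> 'I_n -> nat) :=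
  \sum_(p : 'S_n) \sum_(i : 'I_n) \sum_(j : 'I_n | i < j) \sum_(w | target s p i j w) f p i j w.
have SD f g : S (fun p i j w => f p i j w + g p i j w) = S f + S g.
  rewrite -big_split; apply: eq_bigr => p _; rewrite -big_split; apply: eq_bigr => i _.
  by rewrite -big_split; apply: eq_bigr => j _; rewrite -big_split.
rewrite -/(S (switch_defect s)) /switch_defect !SD.
have mean := sum_near_pairs_le s n_gt1.
have le1 : S (fun p i j w => degree s p j) <=
    (2 * s).+1 ^ 2 * (2 * (2 * (2 * s).+1 ^ 2 * n`!)).
  apply: (@leq_trans ((2 * s).+1 ^ 2 * (2 * \sum_(p : 'S_n) near_pairs s p))).
    rewrite !big_distrr; apply: leq_sum => p _ /=.
    by rewrite -sum_degree; apply: target_sum_moved.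
  by rewrite !leq_mul2l mean !orbT.
have le2 : S (fun p i j w => degree s p ((p^-1)%g w)) <=
    (2 * s).+1 ^ 2 * (2 * (2 * (2 * s).+1 ^ 2 * n`!)).
  apply: (@leq_trans ((2 * s).+1 ^ 2 * (2 * \sum_(p : 'S_n) near_pairs s p))).
    rewrite !big_distrr; apply: leq_sum => p _ /=.
    by rewrite -sum_degree; apply: target_sum_displaced.
  by rewrite !leq_mul2l mean !orbT.
(* Through the identity the third term counts positions [j] with two distinct close neighbours, [i]
   and [x]. *)
have le3 : S (fun p i j w => \sum_(x | x != i) near s (switch p j w) j x) <=
    2 * (4 * (2 * s).+1 ^ 2 * (2 * (2 * s)).+1 ^ 2 * n`!).
  rewrite /S -(sum_near_switch s (fun i j : 'I_n => i < j)
    (fun i j _ q => \sum_(x | x != i) near s q j x)).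
  apply: (@leq_trans (2 * (n.-1 * \sum_(q : 'S_n) \sum_i \sum_j
            near s q i j * \sum_(x | x != j) near s q i x))); last first.
    by rewrite leq_mul2l sum_overlap_le.
  rewrite mulnA big_distrr; apply: leq_sum => q _.
  rewrite exchange_big big_distrr; apply: leq_sum => j _ /=.
  rewrite big_distrr big_mkcond; apply: leq_sum => i _ /=.
  case: ifP => // _; rewrite sum_nat_const cardC1 card_ord nearC mulnCA.
  by rewrite leq_mul2r; apply/orP; right; lia.
(* Here the degrees summed over the free position [y] give at most twice [near_pairs s q], so the
   second moment appears. *)
have le4 : S (fun p i j w => degree s (switch p j w) ((p^-1)%g w)) <=
    2 * (2 * (2 * s).+1 ^ 2 * (2 * (2 * s).+1 ^ 2 + 4 * (2 * s).+1) * n`!).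
  rewrite /S -(sum_near_switch s (fun i j : 'I_n => i < j) (fun i j y q => degree s q y)).
  apply: leq_trans (leq_mul (leqnn 2) (sum_near_pairs2_le s n_gt1)).
  rewrite big_distrr; apply: leq_sum => q _ /=; rewrite mulnCA -sum_degree.
  rewrite /near_pairs big_distrl; apply: leq_sum => i _ /=.
  rewrite big_distrl; apply: leq_sum => j _ /=; rewrite leq_mul2l.
  by rewrite [leqRHS](bigD1 i) //= leq_addl orbT.
apply: leq_trans (leq_add (leq_add le1 le2) (leq_add le3 le4)) _.
rewrite /defect_const /=.
by move: (2 * s).+1 => e; move: (e ^ 2) (_ ^ 2) n`! => c c' f; lia.
Qed.

Definition count_near n s k : nat := #|[set p : 'S_n | near_pairs s p == k]|.

Lemma count_nearE n s k : count_near n s k = \sum_(p : 'S_n) (near_pairs s p == k).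
Proof.
rewrite /count_near -sum1_card big_mkcond; apply: eq_bigr => p _.
by rewrite inE; case: eqP.
Qed.

(** The identity for the indicator of [near_pairs s q = k.+1], on which the weight [near_pairs s q]
    is the constant [k.+1]. *)
Lemma count_near_switch n s k :
  n.-1 * (k.+1 * count_near n s k.+1) =
  \sum_(p : 'S_n) \sum_(i : 'I_n) \sum_(j : 'I_n | i < j) \sum_(w | target s p i j w)
    (near_pairs s (switch p j w) == k.+1).
Proof.
rewrite -(near_pairs_switch s (fun q => near_pairs s q == k.+1 : nat)).
congr (_ * _); rewrite count_nearE big_distrr; apply: eq_bigr => q _ /=.
by case: eqP => [->|]; rewrite ?muln0.
Qed.

(** With [count_near_lower], and after division by [n.-1 * n!], this is the approximate Poisson
    recursion with error of order [1 / n]. *)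
Lemma count_near_upper n s k : 1 < n ->
  n.-1 * (k.+1 * count_near n s k.+1) <=
  n * (s * s.-1) * count_near n s k + defect_const s * n`!.
Proof.
move=> n_gt1; rewrite count_near_switch count_nearE.
apply: leq_trans (leq_add (leqnn _) (sum_switch_defect_le s n_gt1)).
apply: (@leq_trans (\sum_(p : 'S_n) (targets s p * (near_pairs s p == k) +
    \sum_(i : 'I_n) \sum_(j : 'I_n | i < j) \sum_(w | target s p i j w) switch_defect s p i j w))).
  apply: leq_sum => p _; rewrite /targets big_distrl -big_split; apply: leq_sum => i _ /=.
  rewrite big_distrl -big_split; apply: leq_sum => j ij /=.
  rewrite big_distrl -big_split; apply: leq_sum => w tw /=.
  by rewrite mul1n; case: (switch_defectP k ij tw).
rewrite big_split leq_add2r big_distrr; apply: leq_sum => p _ /=.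
by rewrite leq_mul2r targets_upper orbT.
Qed.

Lemma count_near_lower n s k : 1 < n ->
  (n - 3 * s) * (s * s.-1) * count_near n s k <=
  n.-1 * (k.+1 * count_near n s k.+1) + defect_const s * n`!.
Proof.
move=> n_gt1; rewrite count_near_switch count_nearE.
apply: leq_trans (leq_add (leqnn _) (sum_switch_defect_le s n_gt1)).
rewrite -big_split big_distrr; apply: leq_sum => p _ /=.
apply: (@leq_trans (targets s p * (near_pairs s p == k))).
  by rewrite leq_mul2r targets_lower orbT.
rewrite /targets big_distrl -big_split; apply: leq_sum => i _ /=.
rewrite big_distrl -big_split; apply: leq_sum => j ij /=.
rewrite big_distrl -big_split; apply: leq_sum => w tw /=.
by rewrite mul1n; case: (switch_defectP k ij tw).
Qed.

(** * The tail bound *)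

Lemma leq_bigminn (I : finType) (P : pred I) (F : I -> nat) x0 m :
  (m <= \big[minn/x0]_(i | P i) F i) = (m <= x0) && [forall (i | P i), m <= F i].
Proof.
have -> : [forall (i | P i), m <= F i] = all (fun i => P i ==> (m <= F i)) (index_enum I).
  apply/forallP/allP => [h i _|h i]; first exact: h.
  by apply: h; rewrite mem_index_enum.
elim: (index_enum I) => [|i r IH]; first by rewrite big_nil andbT.
rewrite big_cons /=; case: (P i) => //=.
by rewrite leq_min IH andbCA.
Qed.

Lemma leq_dperm n (p : 'S_n) m : (m <= dperm p) =
  (m <= 2 * n) && [forall i : 'I_n, forall (j : 'I_n | i < j),
                    m <= absdiffn i j + absdiffn (p i) (p j)].
Proof.
rewrite /dperm leq_bigminn; case: (leqP m (2 * n)) => //= m_n.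
by apply: eq_forallb => i; rewrite leq_bigminn m_n.
Qed.

Lemma near_pairs_eq0 n s (p : 'S_n) : (near_pairs s p == 0) =
  [forall i : 'I_n, forall (j : 'I_n | i < j), s < absdiffn i j + absdiffn (p i) (p j)].
Proof.
rewrite /near_pairs sum_nat_eq0; apply: eq_forallb => i /=.
rewrite sum_nat_eq0; apply: eq_forallb => j.
case: (ltnP i j) => //= ij; rewrite /near.
have -> : i != j by rewrite -val_eqE /=; lia.
by rewrite eqb0 -ltnNge.
Qed.

(** The side condition keeps the threshold within the neutral element [2 * n] of the minimum. *)
Lemma leq_dperm_near n (p : 'S_n) d : d.+2 <= 2 * n ->
  (d.+2 <= dperm p) = (near_pairs d.+1 p == 0).
Proof. by move=> d_n; rewrite leq_dperm near_pairs_eq0 d_n. Qed.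

Lemma dperm_ge2 n (p : 'S_n) : 0 < n -> 2 <= dperm p.
Proof.
move=> n_gt0; rewrite leq_dperm; apply/andP; split; first by lia.
apply/forallP => i; apply/forall_inP => j ij.
have : p i != p j by rewrite (inj_eq perm_inj) -val_eqE /=; lia.
by rewrite -val_eqE /absdiffn /=; lia.
Qed.

Lemma dperm_le n (p : 'S_n) : 1 < n -> dperm p <= n.
Proof.
move=> n_gt1; have := leqnn (dperm p); rewrite leq_dperm => /andP[_ /forallP].
have n_gt0 : 0 < n by lia.
(* The first two positions alone give a term of at most [1 + (n - 1)]. *)
move=> /(_ (Ordinal n_gt0))/forall_inP/(_ (Ordinal n_gt1) isT) /leq_trans; apply.
set x := p _; set y := p _; rewrite /absdiffn /=.
by have := ltn_ord x; have := ltn_ord y; lia.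
Qed.

Definition count_ge n m : nat := #|[set p : 'S_n | m <= dperm p]|.

Lemma count_ge_near n d : d.+2 <= 2 * n -> count_ge n d.+2 = count_near n d.+1 0.
Proof. by move=> d_n; apply: eq_card => p; rewrite !inE leq_dperm_near. Qed.

Definition sparse_off n D (q : 'S_n) (T : {set 'I_n}) : bool :=
  [forall x, forall y, (x \notin T) ==> (y \notin T) ==> ~~ near D q x y].

(** Contains all that [k] switches can make of a permutation without close pairs at scale [D]: each
    switch adds two exceptional positions to [T]. *)
Definition almost_sparse n D k : {set 'S_n} :=
  [set q | [exists T : {set 'I_n}, (#|T| <= 2 * k) && sparse_off D q T]].

Lemma dperm_sparse n (p : 'S_n) D : D.+2 <= dperm p -> p \in almost_sparse n D.+1 0.
Proof.
rewrite leq_dperm => /andP[_ /forallP sep]; rewrite inE; apply/existsP; exists set0.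
rewrite cards0 /=; apply/forallP => x; apply/forallP => y; rewrite !inE /=.
rewrite /near; case: (ltngtP x y) => [xy|yx|/val_inj ->]; last by rewrite eqxx.
  by move/forall_inP: (sep x) => /(_ y xy); rewrite ltnNge negb_and orbC => ->.
move/forall_inP: (sep y) => /(_ x yx).
by rewrite ltnNge negb_and orbC absdiffnC (absdiffnC (p y)) => ->.
Qed.

Lemma almost_sparse_switch n D k (p : 'S_n) j w :
  p \in almost_sparse n D k -> switch p j w \in almost_sparse n D k.+1.
Proof.
rewrite !inE => /existsP[T /andP[cT /forallP sT]]; apply/existsP.
exists ([set j; (p^-1)%g w] :|: T); apply/andP; split.
  apply: leq_trans (leq_card_setU _ _) _; rewrite cards2 mulnS leq_add //.
  by case: eqP.
apply/forallP => x; apply/forallP => y; rewrite !inE !negb_or.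
apply/implyP => /andP[/andP[xj xw] xT]; apply/implyP => /andP[/andP[yj yw] yT].
by rewrite near_switch_other //; move/forallP: (sT x) => /(_ y); rewrite xT yT.
Qed.

(* By the triangle inequality, a point has at most one neighbour at scale [s <= D / 2]
   outside the exceptional set. *)
Lemma almost_sparse_near_pairs n s D k (q : 'S_n) : 2 * s <= D ->
  q \in almost_sparse n D k -> near_pairs s q <= 2 * k * (2 * k).+1.
Proof.
move=> s_D; rewrite inE => /existsP[T /andP[cT /forallP sT]].
have sep x y : x \notin T -> y \notin T -> near D q x y = false.
  by move=> xT yT; move/forallP: (sT x) => /(_ y); rewrite xT yT => /negbTE.
have deg t : degree s q t <= (2 * k).+1.
  rewrite /degree (bigID (mem T)) /= -[(2 * k).+1]addn1 leq_add //.
    by apply: leq_trans cT; rewrite -sum1_card; apply: leq_sum => x _; case: near.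
  case: (pickP (fun x => (x \notin T) && near s q t x)) => [x0 /andP[x0T tx0]|none].
    rewrite (bigD1 x0) //= tx0 big1 // => x /andP[xT xx0].
    apply/eqP; rewrite eqb0; apply: contraFN (sep _ _ xT x0T).
    move: tx0; rewrite /near xx0 /absdiffn => /andP[_ h] /andP[_ h'] /=; lia.
  by rewrite big1 // => x xT; have := none x; rewrite xT /= => ->.
(* Every close pair meets [T], so the degrees outside [T] sum to at most those inside. *)
suff : 2 * near_pairs s q <= 2 * \sum_(t in T) degree s q t.
  move=> le2; apply: (@leq_trans (\sum_(t in T) (2 * k).+1)); last first.
    by rewrite sum_nat_const leq_mul2r cT orbT.
  by apply: (@leq_trans (\sum_(t in T) degree s q t)); [lia|exact: leq_sum].
rewrite -sum_degree (bigID (mem T)) /= mul2n -addnn leq_add2l.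
rewrite /degree exchange_big /= (bigID (mem T)) /= [X in _ + X]big1 ?addn0.
  apply: leq_sum => t tT; rewrite [leqRHS](bigID (mem T)) /=.
  by apply: leq_trans (leq_addl _ _); apply: leq_sum => x _; rewrite nearC.
move=> x xT; rewrite big1 // => y yT; apply/eqP; rewrite eqb0.
by apply: contraFN (sep _ _ yT xT); rewrite /near => /andP[-> h] /=; lia.
Qed.

(** The identity for the indicator of level [k.+1]: each member of level [k] has at least
    [n.-1 * s.-1] switches, all landing in level [k.+1], whose members have few close pairs. *)
Lemma almost_sparse_step n s D k : 1 < n -> 2 * s <= D -> 2 * s.-1 < n ->
  #|almost_sparse n D k| * s.-1 <=
  2 * k.+1 * (2 * k.+1).+1 * #|almost_sparse n D k.+1|.
Proof.
move=> n_gt1 s_D s_n; rewrite -(leq_pmul2l (_ : 0 < n.-1)); last by lia.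
have cardE (A : {set 'S_n}) : #|A| = \sum_(q : 'S_n) (q \in A).
  by rewrite -sum1_card big_mkcond; apply: eq_bigr => q _; case: (q \in A).
apply: (@leq_trans (n.-1 * \sum_(q : 'S_n) near_pairs s q * (q \in almost_sparse n D k.+1))).
  rewrite near_pairs_switch mulnCA cardE big_distrl; apply: leq_sum => p _ /=.
  case: (boolP (p \in almost_sparse n D k)) => // pA; rewrite mul1n.
  apply: leq_trans (targets_ge p s_n) _.
  apply: leq_sum => i _; apply: leq_sum => j _; apply: leq_sum => w _.
  by rewrite almost_sparse_switch.
rewrite leq_mul2l; apply/orP; right; rewrite cardE big_distrr; apply: leq_sum => q _ /=.
case: (boolP (q \in almost_sparse n D k.+1)) => qA; last by rewrite muln0.
by rewrite !muln1 (almost_sparse_near_pairs s_D).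
Qed.

Lemma almost_sparse_tail n s D K : 1 < n -> 2 * s <= D -> 2 * s.-1 < n ->
  #|almost_sparse n D 0| * s.-1 ^ K <=
  \prod_(k < K) (2 * k.+1 * (2 * k.+1).+1) * n`!.
Proof.
move=> n_gt1 s_D s_n.
apply: (@leq_trans (\prod_(k < K) (2 * k.+1 * (2 * k.+1).+1) * #|almost_sparse n D K|)); last first.
  by rewrite leq_mul2l -card_Sn max_card orbT.
elim: K => [|K IH]; first by rewrite big_ord0 expn0; lia.
rewrite big_ord_recr expnS /= mulnCA mulnC.
apply: leq_trans (leq_mul IH (leqnn _)) _.
rewrite -mulnA -mulnA leq_mul2l; apply/orP; right.
exact: almost_sparse_step.
Qed.

Lemma count_ge_tail K : exists C, forall n D, 1 < n ->
  count_ge n D.+2 * D.+2 ^ K <= C * n`!.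
Proof.
(* The first summand serves [D < 6], where [D.+2 <= 8]; the second serves larger [D], where
   [D.+2 <= 4 * s.-1]. *)
exists (8 ^ K + 4 ^ K * \prod_(k < K) (2 * k.+1 * (2 * k.+1).+1)) => n D n_gt1.
have [D_lt6|D_ge6] := ltnP D 6.
  rewrite mulnDl (leq_trans _ (leq_addr _ _)) // mulnC leq_mul //.
    by case: K => // K; rewrite leq_exp2r //; lia.
  by rewrite -card_Sn max_card.
rewrite mulnDl (leq_trans _ (leq_addl _ _)) //.
have [n_D|D_n] := leqP n D.
  rewrite (_ : count_ge n D.+2 = 0) //; apply/eqP; rewrite cards_eq0; apply/eqP/setP => p.
  by rewrite !inE; have := dperm_le p n_gt1; lia.
(* The largest scale with [2 * s <= D.+1]; as [D < n], it also leaves the room that [targets_ge]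
   asks for. *)
pose s := D.+1./2; have s_D : 2 * s <= D.+1 by rewrite /s; lia.
have s_n : 2 * s.-1 < n by lia.
have D_s : D.+2 <= 4 * s.-1 by rewrite /s; lia.
apply: (@leq_trans (#|almost_sparse n D.+1 0| * (4 * s.-1) ^ K)).
  rewrite leq_mul //; last by case: K => // K; rewrite leq_exp2r.
  by apply: subset_leq_card; apply/subsetP => p; rewrite inE; apply: dperm_sparse.
rewrite expnMn mulnCA -mulnA leq_mul2l; apply/orP; right.
exact: almost_sparse_tail.
Qed.

(** * Tightness of the close-pair counts, and moments by Abel summation *)

Lemma sum_count_near n s K :
  \sum_(k < K) count_near n s k = \sum_(p : 'S_n) (near_pairs s p < K).
Proof.
under eq_bigr => k _ do rewrite count_nearE.
rewrite exchange_big; apply: eq_bigr => p _ /=.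
case: ltnP => pK.
  rewrite (bigD1 (Ordinal pK)) //= eqxx big1 // => k; rewrite -val_eqE /= eq_sym.
  by move=> /negbTE ->.
by rewrite big1 // => k _; apply/eqP; rewrite eqb0; have := ltn_ord k; lia.
Qed.

Lemma sum_count_near_le n s K : \sum_(k < K) count_near n s k <= n`!.
Proof.
rewrite sum_count_near -card_Sn -sum1_card; apply: leq_sum => p _.
by case: ltnP.
Qed.

(** Markov's inequality: pointwise, [K] is at most [K] times the indicator of [near_pairs s p < K],
    plus [near_pairs s p]. *)
Lemma sum_count_near_ge n s K : 1 < n ->
  K * n`! <= K * (\sum_(k < K) count_near n s k) + 2 * (2 * s).+1 ^ 2 * n`!.
Proof.
move=> n_gt1; apply: leq_trans (leq_add (leqnn _) (sum_near_pairs_le s n_gt1)).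
rewrite sum_count_near big_distrr -big_split -card_Sn -sum1_card big_distrr.
by apply: leq_sum => p _ /=; lia.
Qed.

(* The Abel weights: [Y ^ a] is the sum of [moment_weight a d] over the [d] with
   [d + 2 <= Y], for [Y >= 2]. *)
Definition moment_weight a d : nat :=
  if d is d'.+1 then d.+2 ^ a - d.+1 ^ a else 2 ^ a.

Lemma sum_moment_weight a m : 2 <= m -> \sum_(d < m.-1) moment_weight a d = m ^ a.
Proof.
case: m => [|[|m]] // _ /=; elim: m => [|m IH]; first by rewrite big_ord_recr big_ord0.
rewrite big_ord_recr /= IH subnKC //.
by case: a {IH} => // a; rewrite leq_exp2r.
Qed.

(** Every [M >= 2 * n] works since [dperm p <= 2 * n]; thus all late partial sums equal the moment
    exactly, as [tannery] requires. *)
Lemma sum_dperm_powE n a M : 0 < n -> 2 * n <= M ->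
  sum_dperm_pow n a = \sum_(d < M) moment_weight a d * count_ge n d.+2.
Proof.
move=> n_gt0 n_M.
rewrite (eq_bigr (fun d : 'I_M => \sum_(p : 'S_n) (d.+2 <= dperm p) * moment_weight a d)); last first.
  move=> d _; rewrite mulnC -big_distrl /=; congr (_ * _).
  by rewrite /count_ge -sum1_card big_mkcond; apply: eq_bigr => p _; rewrite inE; case: leqP.
rewrite exchange_big; apply: eq_bigr => p _ /=.
have p_ge2 := dperm_ge2 p n_gt0.
have p_M : (dperm p).-1 <= M by have := leqnn (dperm p); rewrite {1}leq_dperm => /andP[]; lia.
rewrite -[LHS](sum_moment_weight a p_ge2) (big_ord_widen _ (moment_weight a) p_M) big_mkcond.
apply: eq_bigr => d _ /=; have -> : (d.+1 < dperm p) = (d < (dperm p).-1) by lia.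
by case: ltnP => _; rewrite ?mul1n.
Qed.

Local Open Scope R_scope.

(** * Limits of real sequences *)

Lemma INRD m n : INR (m + n)%N = INR m + INR n.
Proof. by rewrite -plus_INR. Qed.

Lemma INRM m n : INR (m * n)%N = INR m * INR n.
Proof. by rewrite -mult_INR. Qed.

Lemma INRX m n : INR (expn m n) = INR m ^ n.
Proof. by elim: n => [|n IH] //; rewrite expnS INRM IH. Qed.

Lemma INR_le m n : (m <= n)%N -> INR m <= INR n.
Proof. by move/leP; exact: le_INR. Qed.

Lemma INR_sub_ge m n : INR m - INR n <= INR (m - n)%N.
Proof.
have : INR m <= INR (m - n)%N + INR n by rewrite -INRD; apply: INR_le; lia.
by lra.
Qed.

Lemma INR_fact_gt0 n : 0 < INR (factorial n).
Proof. by apply: lt_0_INR; apply/leP; rewrite fact_gt0. Qed.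

Lemma INR_sum n (F : nat -> nat) :
  INR (\sum_(k < n.+1) F k)%N = sum_f_R0 (fun k => INR (F k)) n.
Proof.
elim: n => [|n IH]; first by rewrite big_ord_recr big_ord0.
by rewrite big_ord_recr INRD IH.
Qed.

Lemma Un_cv_abs_le (u : nat -> R) l C : (forall n, (1 < n)%N -> Rabs (u n - l) <= C / (INR n - 1)) ->
  Un_cv u l.
Proof.
move=> ub eps eps_gt0.
have [N hN] := INR_unbounded (Rabs C / eps + 2).
exists N => n /le_INR le_n.
have C_ge0 := Rabs_pos C.
have q_ge0 : 0 <= Rabs C / eps.
  by apply: Rmult_le_pos => //; left; apply: Rinv_0_lt_compat.
have n_gt1 : (1 < n)%N by apply/ltP; apply: INR_lt; rewrite /=; lra.
apply: Rle_lt_trans (ub n n_gt1) _.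
apply: (Rmult_lt_reg_r (INR n - 1)); first by lra.
have -> : C / (INR n - 1) * (INR n - 1) = C by field; lra.
have : Rabs C / eps * eps = Rabs C by field; lra.
have := Rle_abs C; nra.
Qed.

Lemma Un_cv_eq (u v : nat -> R) l N :
  (forall n, (N <= n)%N -> u n = v n) -> Un_cv u l -> Un_cv v l.
Proof.
move=> uv cu eps /cu[M hM]; exists (maxn N M) => n /leP n_ge.
rewrite -uv; last by lia.
by apply: hM; apply/leP; lia.
Qed.

Lemma Un_cv_const c : Un_cv (fun=> c) c.
Proof. by move=> eps eps_gt0; exists 0%N => n _; rewrite R_dist_eq. Qed.

Lemma Un_cv_le (u : nat -> R) l c N :
  (forall n, (N <= n)%N -> u n <= c) -> Un_cv u l -> l <= c.
Proof.
move=> uc cu; apply: Rnot_lt_le => c_l.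
have [M hM] := cu (l - c) ltac:(lra).
have := hM (maxn N M) ltac:(apply/leP; lia); have := uc (maxn N M) ltac:(lia).
by rewrite /Rdist => ? /Rabs_def2; lra.
Qed.

Lemma Un_cv_ge (u : nat -> R) l c N :
  (forall n, (N <= n)%N -> c <= u n) -> Un_cv u l -> c <= l.
Proof.
move=> uc /CV_opp cu; suff : - l <= - c by lra.
by apply: (Un_cv_le (N := N)) cu => n /uc; rewrite /opp_seq; lra.
Qed.

(** * Poisson limit from an approximate recursion and tightness *)

Section PoissonRecursion.
Variables (lam B : R) (p : nat -> nat -> R).
Hypothesis lam_ge0 : 0 <= lam.
Hypothesis p0_ge0 : forall n, 0 <= p n 0.
Hypothesis rec_cvg : forall k, Un_cv (fun n => INR k.+1 * p n k.+1 - lam * p n k) 0.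
Hypothesis sum_p_le1 : forall n K, (1 < n)%N -> sum_f_R0 (p n) K <= 1.
Hypothesis sum_p_ge : forall n K, (1 < n)%N -> 1 - B / INR K.+1 <= sum_f_R0 (p n) K.

Let poisson_term k := / INR (fact k) * lam ^ k.

(** Induction on [k]: the recursion multiplies the ratio to [p n 0] by [lam / k.+1], up to a
    vanishing error. *)
Lemma poisson_term_cvg k : Un_cv (fun n => p n k - p n 0%N * poisson_term k) 0.
Proof.
elim: k => [|k IH].
  apply: (@Un_cv_eq (fun=> 0) _ _ 0) (Un_cv_const 0) => n _.
  by rewrite /poisson_term /= Rinv_1; ring.
have k_gt0 : 0 < INR k.+1 by apply: lt_0_INR; apply/leP.
have fk : INR (fact k) <> 0 by apply: INR_fact_neq_0.
have := CV_mult _ _ _ _ (Un_cv_const (/ INR k.+1))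
  (CV_plus _ _ _ _ (rec_cvg k) (CV_mult _ _ _ _ (Un_cv_const lam) IH)).
have -> : / INR k.+1 * (0 + lam * 0) = 0 by ring.
apply: (@Un_cv_eq _ _ _ 0) => n _; rewrite /poisson_term.
have -> : fact k.+1 = (k.+1 * fact k)%N by [].
rewrite INRM /=; field; split => //.
by move: k_gt0; rewrite /=; lra.
Qed.

Lemma poisson_sum_cvg K :
  Un_cv (fun n => sum_f_R0 (p n) K - p n 0%N * sum_f_R0 poisson_term K) 0.
Proof.
elim: K => [|K IH]; first exact: (poisson_term_cvg 0).
have := CV_plus _ _ _ _ IH (poisson_term_cvg K.+1); rewrite Rplus_0_r.
by apply: (@Un_cv_eq _ _ _ 0) => n _ /=; ring.
Qed.

(** For large [K], the sum of the first [p n k] is near 1 by tightness and near [p n 0 * exp lam] by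
    the recursion. *)
Lemma poisson_limit : Un_cv (fun n => p n 0%N) (exp (- lam)).
Proof.
move=> eps eps_gt0.
have exp_sum : infinite_sum poisson_term (exp lam) by exact: (proj2_sig (exist_exp lam)).
have [K1 hK1] := exp_sum (eps / 3) ltac:(lra).
have [K2 hK2] := INR_unbounded (Rabs B / (eps / 3)).
pose K := maxn K1 K2.
have {}hK1 : Rabs (sum_f_R0 poisson_term K - exp lam) < eps / 3.
  by apply: hK1; apply/leP; rewrite /K; lia.
have [N hN] := poisson_sum_cvg K (eps := eps / 3) ltac:(lra).
exists (maxn N 2) => n /leP n_ge.
have n_gt1 : (1 < n)%N by lia.
have {hN} := hN n ltac:(apply/leP; lia); rewrite /Rdist Rminus_0_r => hN.
have K_gt : INR K.+1 > Rabs B / (eps / 3).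
  by have := @INR_le K2 K.+1 ltac:(rewrite /K; lia); lra.
have B_ge0 := Rabs_pos B.
have BK : B / INR K.+1 < eps / 3.
  have K0 : 0 < INR K.+1 by apply: lt_0_INR; apply/leP.
  apply: (Rmult_lt_reg_r (INR K.+1)) => //.
  have -> : B / INR K.+1 * INR K.+1 = B by field; lra.
  have : Rabs B / (eps / 3) * (eps / 3) = Rabs B by field; lra.
  by have := Rle_abs B; nra.
have := sum_p_le1 K n_gt1; have := sum_p_ge K n_gt1.
have p0_le1 : p n 0%N <= 1 by apply: (sum_p_le1 0 n_gt1).
have p0_ge := p0_ge0 n.
move: hK1 hN; set S := sum_f_R0 (p n) K; set E := sum_f_R0 _ K.
move=> /Rabs_def2[? ?] /Rabs_def2[? ?] ? ?.
(* Three errors of at most [eps / 3]: [S] against 1, [S] against [p n 0 * E], and [E] against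
   [exp lam], the last scaled by [p n 0 <= 1]. *)
have key : Rabs (p n 0%N * exp lam - 1) < eps.
  have : - (eps / 3) <= p n 0%N * (exp lam - E) <= eps / 3 by split; nra.
  by move=> ?; apply: Rabs_def1; lra.
have e1 : exp (- lam) * exp lam = 1 by rewrite -exp_plus Rplus_opp_l exp_0.
have e_gt0 := exp_pos (- lam).
have e_le1 : exp (- lam) <= 1 by have := exp_ineq1_le lam; have := exp_pos lam; nra.
have -> : p n 0%N - exp (- lam) = exp (- lam) * (p n 0%N * exp lam - 1) by nra.
by rewrite Rabs_mult (Rabs_pos_eq (exp (- lam))); [have := Rabs_pos (p n 0%N * exp lam - 1); nra | lra].
Qed.

End PoissonRecursion.

(** * Dominated convergence for series *)

Section Tannery.
Variables (C : R) (u : nat -> R) (f : nat -> nat -> R) (h : nat -> R).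
Hypothesis f_le : forall n d, (1 < n)%N -> 0 <= f n d <= C / (INR d.+1 * INR d.+2).
Hypothesis f_cvg : forall d, Un_cv (fun n => f n d) (h d).
Hypothesis u_sum : forall n, (1 < n)%N -> exists M0, forall M, (M0 <= M)%N -> u n = sum_f_R0 (f n) M.

(** The dominating term [C / ((d + 1) * (d + 2))] is a difference of consecutive values of
    [C / (d + 1)], so its tails are explicit. *)
Lemma tannery_telescope (g : nat -> R) D M :
  (forall d, 0 <= g d <= C / (INR d.+1 * INR d.+2)) -> (D <= M)%N ->
  0 <= sum_f_R0 g M - sum_f_R0 g D <= C * / INR D.+2 - C * / INR M.+2.
Proof.
move=> g_le; elim: M => [|M IH].
  by rewrite leqn0 => /eqP ->; lra.
rewrite leq_eqVlt => /orP[/eqP ->|]; first by lra.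
rewrite ltnS => /IH; rewrite tech5; have := g_le M.+1.
have -> : C / (INR M.+2 * INR M.+3) = C * / INR M.+2 - C * / INR M.+3.
  by have M_ge0 := pos_INR M; rewrite !S_INR; field; lra.
by lra.
Qed.

Lemma tannery_limit_bound d : 0 <= h d <= C / (INR d.+1 * INR d.+2).
Proof.
split; [apply: (Un_cv_ge (N := 2)) (f_cvg d)|apply: (Un_cv_le (N := 2)) (f_cvg d)].
  by move=> n /(f_le d)[].
by move=> n /(f_le d)[].
Qed.

Lemma tannery_const_ge0 : 0 <= C.
Proof.
have := tannery_limit_bound 0; have -> : C / (INR 1 * INR 2) = C / 2 by rewrite /=; field.
by lra.
Qed.

Lemma tannery_tail_small eps : 0 < eps -> exists D, C * / INR D.+2 < eps.
Proof.
move=> eps_gt0; have [D hD] := INR_unbounded (C / eps); exists D.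
have D_ge0 := pos_INR D; have C0 := tannery_const_ge0.
apply: (Rmult_lt_reg_r (INR D.+2)); first by rewrite !S_INR; lra.
have -> : C * / INR D.+2 * INR D.+2 = C by field; rewrite !S_INR; lra.
have : C / eps * eps = C by field; lra.
by rewrite !S_INR; nra.
Qed.

Lemma tannery_tail_ge0 M : 0 <= C * / INR M.+2.
Proof.
apply: Rmult_le_pos tannery_const_ge0 _; left; apply: Rinv_0_lt_compat.
by apply: lt_0_INR; apply/leP.
Qed.

Lemma tannery_partial_cvg D : Un_cv (fun n => sum_f_R0 (f n) D) (sum_f_R0 h D).
Proof.
elim: D => [|D IH]; first exact: f_cvg.
exact: CV_plus IH (f_cvg D.+1).
Qed.

(** Cut at a [D] beyond which both series have small tails uniformly in [n]; the finite remainder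
    converges termwise. *)
Lemma tannery : exists L, infinite_sum h L /\ Un_cv u L.
Proof.
have h_cauchy : Cauchy_crit (sum_f_R0 h).
  move=> eps eps_gt0; have [D hD] := tannery_tail_small (eps := eps / 2) ltac:(lra).
  exists D => n m /leP Dn /leP Dm.
  have := tannery_telescope tannery_limit_bound Dn.
  have := tannery_telescope tannery_limit_bound Dm.
  have := tannery_tail_ge0 n; have := tannery_tail_ge0 m.
  by rewrite /Rdist => *; apply: Rabs_def1; lra.
have [L hL] := R_complete _ h_cauchy; exists L; split=> // eps eps_gt0.
have [D hD] := tannery_tail_small (eps := eps / 3) ltac:(lra).
have [N hN] := tannery_partial_cvg D (eps := eps / 3) ltac:(lra).
have H_le : L <= sum_f_R0 h D + C * / INR D.+2.
  apply: (Un_cv_le (N := D)) hL => n Dn.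
  by have := tannery_telescope tannery_limit_bound Dn; have := tannery_tail_ge0 n; lra.
have H_ge : sum_f_R0 h D <= L.
  by apply: (Un_cv_ge (N := D)) hL => n Dn; have := tannery_telescope tannery_limit_bound Dn; lra.
exists (maxn N 2) => n /leP n_ge.
have n_gt1 : (1 < n)%N by lia.
have [M0 hM0] := u_sum n_gt1; rewrite (hM0 (maxn M0 D)); last by lia.
have := tannery_telescope (fun d => f_le d n_gt1) (leq_maxr M0 D).
have := tannery_tail_ge0 (maxn M0 D).
have := hN n ltac:(apply/leP; lia); rewrite /Rdist => /Rabs_def2 *.
by apply: Rabs_def1; lra.
Qed.

End Tannery.

(** * Convergence of the moments *)

Definition prob_near n s k : R := INR (count_near n s k) / INR (factorial n).

Lemma div_fact_le n (c : nat) x :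
  INR c <= x * INR (factorial n) -> INR c / INR (factorial n) <= x.
Proof.
have f_gt0 := INR_fact_gt0 n => le_c; apply: (Rmult_le_reg_r (INR (factorial n))) => //.
by have -> : INR c / INR (factorial n) * INR (factorial n) = INR c by field; lra.
Qed.

Lemma div_fact_ge0 n (c : nat) : 0 <= INR c / INR (factorial n).
Proof.
apply: Rmult_le_pos (pos_INR _) _; left.
by apply: Rinv_0_lt_compat; apply: INR_fact_gt0.
Qed.

Lemma sum_prob_near n s K :
  sum_f_R0 (prob_near n s) K =
  INR (\sum_(k < K.+1) count_near n s k)%N / INR (factorial n).
Proof. by rewrite INR_sum /Rdiv Rmult_comm scal_sum. Qed.

Lemma prob_near_rec_cvg s k :
  Un_cv (fun n => INR k.+1 * prob_near n s k.+1 - INR (s * s.-1)%N * prob_near n s k) 0.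
Proof.
move: (defect_const s) (fun n => @count_near_upper n s k)
  (fun n => @count_near_lower n s k) => dc upper lower.
pose lam := INR (s * s.-1)%N; pose D := INR dc.
(* Replacing [n] by [n - 1] costs [lam], the [3 * s] boundary anchors cost [3 * lam * s], and [D]
   comes from the defects. *)
apply: (@Un_cv_abs_le _ _ (lam * (1 + 3 * INR s) + D)) => n n_gt1.
have f_gt0 := INR_fact_gt0 n.
have lam_ge0 : 0 <= lam by apply: pos_INR.
have s_ge0 := pos_INR s; have D_ge0 : 0 <= D by apply: pos_INR.
have p_ge0 : 0 <= prob_near n s k by apply: div_fact_ge0.
have p_le1 : prob_near n s k <= 1.
  apply: div_fact_le; rewrite Rmult_1_l; apply: INR_le.
  by rewrite /count_near -card_Sn max_card.
have pE j : INR (count_near n s j) = prob_near n s j * INR (factorial n).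
  by rewrite /prob_near; field; lra.
have n1 : INR n.-1 = INR n - 1.
  by have := S_INR n.-1; rewrite prednK; [lra | lia].
have n_ge2 : 2 <= INR n by have := INR_le n_gt1; rewrite /=; lra.
have up := INR_le (upper n n_gt1).
have lo := INR_le (lower n n_gt1).
have lamE : lam = INR s * INR s.-1 by apply: INRM.
rewrite !(INRD, INRM) !pE n1 -lamE -/D in up lo.
have {}up : (INR n - 1) * (INR k.+1 * prob_near n s k.+1) <= INR n * lam * prob_near n s k + D.
  by apply: (Rmult_le_reg_r (INR (factorial n))) => //; lra.
have {}lo : INR (n - 3 * s)%N * lam * prob_near n s k
    <= (INR n - 1) * (INR k.+1 * prob_near n s k.+1) + D.
  by apply: (Rmult_le_reg_r (INR (factorial n))) => //; lra.
(* Truncated subtraction can only be larger, so this holds also for [n < 3 * s]. *)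
have sub : INR n - 3 * INR s <= INR (n - 3 * s)%N.
  by have := INR_sub_ge n (3 * s); rewrite INRM /=; lra.
have {}lo : (INR n - 3 * INR s) * (lam * prob_near n s k)
    <= (INR n - 1) * (INR k.+1 * prob_near n s k.+1) + D.
  by apply: Rle_trans lo; rewrite Rmult_assoc; apply: Rmult_le_compat_r => //; nra.
move: up lo; set a := INR k.+1 * _; set x := prob_near n s k in p_ge0 p_le1 *.
have : 0 <= lam * x <= lam by nra.
rewrite Rmult_assoc; set y := lam * x => y_le up lo.
have ys : y * INR s <= lam * INR s by nra.
have ys0 : 0 <= y * INR s by nra.
rewrite Rminus_0_r; apply: Rabs_le; split.
  apply: (Rmult_le_reg_r (INR n - 1)); first by lra.
  have -> : - ((lam * (1 + 3 * INR s) + D) / (INR n - 1)) * (INR n - 1) =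
     - (lam * (1 + 3 * INR s) + D) by field; lra.
  by lra.
apply: (Rmult_le_reg_r (INR n - 1)); first by lra.
have -> : (lam * (1 + 3 * INR s) + D) / (INR n - 1) * (INR n - 1) =
   lam * (1 + 3 * INR s) + D by field; lra.
have ls_ge0 : 0 <= lam * INR s by nra.
by lra.
Qed.

Lemma prob_near0_cvg s : Un_cv (fun n => prob_near n s 0%N) (exp (- INR (s * s.-1)%N)).
Proof.
apply: (@poisson_limit _ (INR (2 * (2 * s).+1 ^ 2)%N) (fun n => prob_near n s)) => [||k|n K n_gt1|n K n_gt1].
- exact: pos_INR.
- by move=> n; apply: div_fact_ge0.
- exact: prob_near_rec_cvg.
- rewrite sum_prob_near; apply: div_fact_le; rewrite Rmult_1_l.
  exact/INR_le/sum_count_near_le.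
rewrite sum_prob_near.
have K_gt0 : 0 < INR K.+1 by apply: lt_0_INR; apply/leP.
have f_gt0 := INR_fact_gt0 n.
have := INR_le (sum_count_near_ge s K.+1 n_gt1).
move: (2 * (2 * s).+1 ^ 2)%N => B; rewrite INRD !INRM; set c := INR (\sum_(_ < _) _)%N => le_c.
apply: (Rmult_le_reg_r (INR K.+1 * INR (factorial n))); first by nra.
have -> : (1 - INR B / INR K.+1) * (INR K.+1 * INR (factorial n)) =
  INR K.+1 * INR (factorial n) - INR B * INR (factorial n) by field; lra.
have -> : c / INR (factorial n) * (INR K.+1 * INR (factorial n)) = INR K.+1 * c by field; lra.
by lra.
Qed.

Definition prob_ge n d : R := INR (count_ge n d.+2) / INR (factorial n).

(** The limiting tail [Pr[Y >= d + 2]]. *)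
Definition limit_tail d : R := exp (- (INR d) ^ 2 - INR d).

Lemma prob_ge_cvg d : Un_cv (fun n => prob_ge n d) (limit_tail d).
Proof.
have -> : limit_tail d = exp (- INR (d.+1 * d.+1.-1)%N).
  by rewrite /limit_tail INRM S_INR /=; congr exp; ring.
apply: (@Un_cv_eq (fun n => prob_near n d.+1 0%N) _ _ d.+2) (prob_near0_cvg d.+1) => n n_ge.
by rewrite /prob_ge count_ge_near //; lia.
Qed.

Lemma moment_weight_le a d : (moment_weight a d <= expn d.+2 a)%N.
Proof. by case: d => [|d] //=; apply: leq_subr. Qed.

Lemma EYn_pow_cvg a : exists L : R,
  infinite_sum (fun d => INR (moment_weight a d) * limit_tail d) L /\
  Un_cv (fun n => EYn_pow n a) L.
Proof.
(* Of the exponent [a + 2], the power [a] pays for the moment weight and the remaining square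
   dominates [(d + 1) * (d + 2)]. *)
have [C tail] := count_ge_tail a.+2.
apply: (@tannery (INR C) _ (fun n d => INR (moment_weight a d) * prob_ge n d)).
- move=> n d n_gt1; split.
    by apply: Rmult_le_pos (pos_INR _) (div_fact_ge0 _ _).
  rewrite /prob_ge /Rdiv -Rmult_assoc -INRM; apply: div_fact_le.
  apply: (Rmult_le_reg_r (INR d.+1 * INR d.+2)).
    by apply: Rmult_lt_0_compat; apply: lt_0_INR; apply/leP.
  have d_ge0 := pos_INR d.
  have -> : INR C * / (INR d.+1 * INR d.+2) * INR (factorial n) * (INR d.+1 * INR d.+2) =
     INR C * INR (factorial n) by field; rewrite !S_INR; lra.
  rewrite -!INRM; apply: INR_le; apply: leq_trans (tail n d n_gt1).
  rewrite [leqLHS](_ : _ = count_ge n d.+2 * (d.+1 * d.+2 * moment_weight a d))%N; last by lia.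
  rewrite leq_mul2l !expnS mulnA; apply/orP; right.
  by rewrite leq_mul ?moment_weight_le // leq_mul.
- move=> d; apply: CV_mult (Un_cv_const _) (prob_ge_cvg d).
- move=> n n_gt1; exists (2 * n)%N => M n_M.
  rewrite /EYn_pow (@sum_dperm_powE n a M.+1); [|by lia..].
  rewrite (INR_sum M (fun d => moment_weight a d * count_ge n d.+2)%N).
  rewrite /Rdiv Rmult_comm scal_sum; apply: PartSum.sum_eq => d _.
  by rewrite INRM /prob_ge /Rdiv Rmult_assoc.
Qed.

(** The bound on the finite tails is uniform in [n] and passes to the limit. *)
Lemma limit_tail_le K : exists C, forall d, limit_tail d * INR d.+2 ^ K <= C.
Proof.
have [C tail] := count_ge_tail K; exists (INR C) => d.
have := CV_mult _ _ _ _ (prob_ge_cvg d) (Un_cv_const (INR d.+2 ^ K)).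
apply: (Un_cv_le (N := 2)) => n n_gt1.
rewrite /prob_ge /Rdiv Rmult_assoc (Rmult_comm (/ _)) -Rmult_assoc -INRX -INRM.
by apply: div_fact_le; rewrite -INRM; apply: INR_le; apply: tail.
Qed.

(** This is the boundary term of the Abel summation for [Y]; one extra power in the tail bound makes
    it vanish. *)
Lemma pow_limit_tail_cvg a : Un_cv (fun d => INR d.+2 ^ a * limit_tail d.+1) 0.
Proof.
have [C tail] := limit_tail_le a.+1.
have C_ge0 : 0 <= C.
  apply: Rle_trans (tail 0%N); apply: Rmult_le_pos; first by left; apply: exp_pos.
  by apply: pow_le; apply: pos_INR.
apply: (@Un_cv_abs_le _ _ C) => d d_gt1; rewrite Rminus_0_r.
have d_ge2 : 2 <= INR d by have := INR_le d_gt1; rewrite /=; lra.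
have t_gt0 : 0 < limit_tail d.+1 by apply: exp_pos.
have x_ge0 : 0 <= INR d.+2 ^ a by apply: pow_le; apply: pos_INR.
rewrite Rabs_pos_eq; last by nra.
apply: (Rmult_le_reg_r (INR d - 1)); first by lra.
have -> : C / (INR d - 1) * (INR d - 1) = C by field; lra.
apply: Rle_trans (tail d.+1).
have le_x : INR d.+2 ^ a <= INR d.+3 ^ a.
  by apply: pow_incr; split; [apply: pos_INR | apply: INR_le].
rewrite [INR d.+3 ^ _]/= -/(INR d.+3).
have -> : INR d.+2 ^ a * limit_tail d.+1 * (INR d - 1) =
  limit_tail d.+1 * ((INR d - 1) * INR d.+2 ^ a) by ring.
apply: Rmult_le_compat_l; first by lra.
by apply: Rmult_le_compat => //; [lra | rewrite !S_INR; lra].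
Qed.

(** Summation by parts, from the point probabilities of [Y] to its tails. *)
Lemma sum_EY_pow_term a M :
  sum_f_R0 (EY_pow_term a) M =
  sum_f_R0 (fun d => INR (moment_weight a d) * limit_tail d) M -
  INR M.+2 ^ a * limit_tail M.+1.
Proof.
have termE d : EY_pow_term a d = INR d.+2 ^ a * (limit_tail d - limit_tail d.+1).
  by rewrite /EY_pow_term /probY /limit_tail !S_INR; congr (_ ^ _ * _); ring.
have weightE d : INR (moment_weight a d.+1) = INR d.+3 ^ a - INR d.+2 ^ a.
  have le_pow : (expn d.+2 a <= expn d.+3 a)%N by case: a {termE} => // a; rewrite leq_exp2r.
  suff : INR (moment_weight a d.+1) + INR d.+2 ^ a = INR d.+3 ^ a by lra.
  by rewrite -!INRX -INRD subnK.
elim: M => [|M IH]; first by rewrite /= termE INRX /=; ring.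
by rewrite !tech5 IH termE weightE; ring.
Qed.

Theorem theorem3 (a : nat) :
  (exists L : R, infinite_sum (EY_pow_term a) L /\
                 Un_cv (fun n => EYn_pow n a) L) /\
  (exists S : R, infinite_sum (fun d : nat => exp (- (INR d)^2 - INR d)) S /\
                 Un_cv (fun n => EYn_pow n 1) (1 + S)).
Proof.
split.
  have [L [sumL cvL]] := EYn_pow_cvg a; exists L; split => //.
  have := CV_minus _ _ _ _ sumL (pow_limit_tail_cvg a); rewrite Rminus_0_r.
  by apply: (@Un_cv_eq _ _ _ 0) => M _; rewrite sum_EY_pow_term.
(* For [a = 1] the weights are 2 at [d = 0] and 1 afterwards; as [limit_tail 0 = 1], the moment
   series exceeds the plain series of tails by 1. *)
have [L [sumL cvL]] := EYn_pow_cvg 1; exists (L - 1); split; last first.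
  by have -> : 1 + (L - 1) = L by ring.
have := CV_minus _ _ _ _ sumL (Un_cv_const 1).
apply: (@Un_cv_eq _ _ _ 0) => M _.
suff -> : sum_f_R0 (fun d => INR (moment_weight 1 d) * limit_tail d) M =
  sum_f_R0 limit_tail M + 1 by rewrite /limit_tail; ring.
elim: M => [|M IH]; first by rewrite /limit_tail /= !(Rmult_0_l, Ropp_0, Rminus_0_r) exp_0; ring.
rewrite !tech5 IH (_ : moment_weight 1 M.+1 = 1)%N; first by rewrite /=; ring.
by rewrite /= !expn1; lia.
Qed.
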